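(* Each $T_0$ weakly semiregular semitopological group $(G,\tau)$ is semiregular.
   Context: A semitopological group is a group $G$ endowed with a topology such that the multiplication map $G\times G\to G$, $(x,y)\mapsto xy$, is separately continuous. A topological space $X$ is $T_0$ if for any distinct points $x,y\in X$ there exists an open set containing exactly one of $x,y$; weakly semiregular if it has a base consisting of regular open sets, i.e. sets $U$ with $U=\operatorname{int}\overline{U}$; semiregular if it is weakly semiregular and $T_2$ (Hausdorff). No separation axioms are assumed unless stated. *)

(* Defs.v *)
From HB Require Import structures.
From mathcomp Require Import all_boot.
From mathcomp Require Import all_classical.
From mathcomp Require Import topology.

Set Implicit Arguments.
Unset Strict Implicit.
Unset Printing Implicit Defensive.

Local Open Scope classical_set_scope.
Local Open Scope group_scope.

HB.structure Definition PreTopologicalGroup := {G of Topological G & Group G}.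

HB.mixin Record PreTopologicalGroup_isSemitopological (G : Type)
    & PreTopologicalGroup G := {
  continuous_mulgl : forall x : G, continuous (fun y : G => x * y) ;
  continuous_mulgr : forall y : G, continuous (fun x : G => x * y)
}.

#[short(type="semitopologicalGroupType")]
HB.structure Definition SemitopologicalGroup :=
  {G of PreTopologicalGroup G & PreTopologicalGroup_isSemitopological G}.

Definition weakly_semiregular_space (T : topologicalType) :=
  exists2 B : set (set T), basis B & B `<=` @regopen T.

Definition semiregular_space (T : topologicalType) :=
  weakly_semiregular_space T /\ hausdorff_space T.

(* Main.v *)
Require Import Defs.
From mathcomp Require Import all_boot all_classical topology.

(** Call two points inseparable when every neighborhood of one meets every
    neighborhood of the other; this is [cluster (nbhs x) y], and a space is
    Hausdorff when inseparable points are equal.  The heart of the argument is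
    that in a semitopological group a regular open set [U] containing [x] also
    contains every point [y] inseparable from [x].  Indeed, right translations
    preserve inseparability, so that for each [u] in [U] the point
    [y x^-1 u] is inseparable from [u], hence lies in the closure of [U].  The
    left translate [y x^-1 U] is therefore an open set inside the closure of
    [U], and it contains [y]: thus [y] is interior to the closure of [U], which
    means that [y] is in [U] ([regopen_cluster_nbhs]).

    When the regular open sets form a base, every neighborhood of [x] then
    contains [y], and by symmetry every neighborhood of [y] contains [x]; the
    T0 axiom forces [x = y]. *)

Local Open Scope classical_set_scope.
Local Open Scope group_scope.

(** Neighborhoods of [f x] and [f y] pull back to neighborhoods of [x] and [y],
    and a common point of the preimages is mapped to a common point. *)
Lemma continuous_cluster_nbhs (S T : topologicalType) (f : S -> T) (x y : S) :
  continuous f -> cluster (nbhs x) y -> cluster (nbhs (f x)) (f y).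
Proof.
move=> fc xy A B /fc fxA /fc fyB.
by have [z [Az Bz]] := xy _ _ fxA fyB; exists (f z).
Qed.

Lemma cluster_nbhs_sym (T : topologicalType) (x y : T) :
  cluster (nbhs x) y -> cluster (nbhs y) x.
Proof. by move=> xy A B yA xB; rewrite setIC; exact: xy. Qed.

(** Each continuity has its own task: that of right translations makes the pair
    [(u, y x^-1 u)] inseparable along with [(x, y)], and that of left
    translations makes [y x^-1 U] a neighborhood of [y]. *)
Lemma regopen_cluster_nbhs (G : semitopologicalGroupType) (U : set G)
    (x y : G) :
  regopen U -> U x -> cluster (nbhs x) y -> U y.
Proof.
move=> regU Ux xy.
have U_nbhs u : U u -> nbhs u U.
  by rewrite -{1}regU => /nbhs_interior; rewrite regU.
rewrite -regU.
have yU : nbhs y [set z | U (x * y^-1 * z)].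
  apply: (@continuous_mulgl G (x * y^-1)).
  by rewrite mulgVK; exact: U_nbhs.
apply: filterS yU => z /= Uz B zB.
(* The right translation by t carries x to x y^-1 z, a point of U, and y to z. *)
pose t := y^-1 * z.
have := @continuous_cluster_nbhs _ _ _ _ _ (@continuous_mulgr G t) xy.
rewrite /t mulgA mulVKg => uz; apply: uz zB.
exact: U_nbhs.
Qed.

Lemma weakly_semiregular_cluster_nbhs (G : semitopologicalGroupType)
    (x y : G) (A : set G) :
  weakly_semiregular_space G -> cluster (nbhs x) y -> nbhs x A -> A y.
Proof.
move=> [B [_ Bbase] Breg] xy /Bbase[U [BU Ux]] UA; apply: UA.
exact: regopen_cluster_nbhs _ _ _ _ (Breg _ BU) Ux xy.
Qed.

Theorem proposition1 (G : semitopologicalGroupType) :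
  @kolmogorov_space G -> weakly_semiregular_space G -> semiregular_space G.
Proof.
move=> T0 wsr; split=> // x y xy; apply/eqP/negP => /negP /T0[A].
case=> -[/set_mem nA /set_mem]; apply.
  exact: weakly_semiregular_cluster_nbhs _ _ _ _ wsr xy nA.
exact: weakly_semiregular_cluster_nbhs _ _ _ _ wsr (cluster_nbhs_sym _ _ _ xy) nA.
Qed.
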